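(* Let $G=(S,T;E)$ be a bipartite graph with colour classes $S$ and $T$ such that each node in $S$ has degree at most $4$ and each node in $T$ has degree at most $3$. Then $G$ has a matching $M\subseteq E$ and a family $\mathcal{F}$ of pairwise node-disjoint $S$-links of $G$ such that every node $v\in T$ of degree $3$ in $G$ is incident to at least one edge of $M\cup\bigcup_{P\in\mathcal{F}}E(P)$, where $E(P)$ denotes the edge set of $P$.
   Context: All graphs are finite and simple. A matching in a graph is a set of edges such that every node is incident to at most one of them. In a bipartite graph $G=(S,T;E)$, an $S$-link is a path of length $2$ in $G$ (two edges $uv,vw$ with $u\neq w$) whose end-nodes $u,w$ are in $S$ (so its middle node $v$ is in $T$). Node-disjointness is required only among the $S$-links in $\mathcal{F}$ (including both end-nodes and middle nodes); edges of $M$ may share nodes with the $S$-links. *)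

(* Defs.v *)
From mathcomp Require Import all_boot.

Set Implicit Arguments.
Unset Strict Implicit.
Unset Printing Implicit Defensive.

(* A finite graph on the node set V is given by its adjacency relation e. *)

Definition simple_graph (V : finType) (e : rel V) : Prop :=
  symmetric e /\ irreflexive e.

Definition bipartition (V : finType) (e : rel V) (S T : {set V}) : Prop :=
  [/\ S :|: T = [set: V], [disjoint S & T] &
      forall x y, e x y ->
        (x \in S) && (y \in T) || (x \in T) && (y \in S)].

Definition degree (V : finType) (e : rel V) (v : V) : nat :=
  #|[set w | e v w]|.

(* Edges are unordered pairs of nodes. *)
Definition edge_set (V : finType) (e : rel V) : {set {set V}} :=
  [set [set p.1; p.2] | p : V * V & e p.1 p.2].

Definition matching (V : finType) (e : rel V) (M : {set {set V}}) : Prop :=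
  M \subset edge_set e /\ forall v : V, #|[set f in M | v \in f]| <= 1.

(* A path of length 2 is encoded by its node sequence (u, v, w), with middle
   node v.  The triples (u, v, w) and (w, v, u) describe the same path; since
   they share nodes, a node-disjoint set of triples contains at most one of
   them. *)
Definition S_link (V : finType) (e : rel V) (S : {set V}) (P : V * V * V)
    : bool :=
  let: (u, v, w) := P in [&& e u v, e v w, u != w, u \in S & w \in S].

Definition link_nodes (V : finType) (P : V * V * V) : {set V} :=
  let: (u, v, w) := P in [set u; v; w].

Definition link_edges (V : finType) (P : V * V * V) : {set {set V}} :=
  let: (u, v, w) := P in [set [set u; v]; [set v; w]].

Definition disjoint_S_links (V : finType) (e : rel V) (S : {set V})
    (F : {set V * V * V}) : Prop :=
  (forall P, P \in F -> S_link e S P) /\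
  (forall P Q, P \in F -> Q \in F -> P != Q ->
     [disjoint link_nodes P & link_nodes Q]).

(* Main.v *)
Require Import Defs.
From mathcomp Require Import all_boot.
From mathcomp Require Import zify.
From Stdlib Require Import Classical.

Set Implicit Arguments.
Unset Strict Implicit.
Unset Printing Implicit Defensive.

(** Regard the nodes of degree 3 in [T] as triples of points of [S], each point
    lying in at most four of them.  We seek disjoint pairs, each inside its own
    triple, such that the remaining triples have distinct representatives.  If
    every point loses a triple to the pairs, Hall's condition holds by counting
    3 against 3; only unpaired points of degree 4 are dangerous.

    As in the Gallai-Edmonds theorem there is a set [B] of points whose removal
    leaves blocks, no triple meeting two of them, each of which can be paired up
    after deletion of an arbitrary point.  Attach the points of [B] to distinct
    blocks.  Counting the incidences between [B] and the triples that meet a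
    block, one can also serve all blocks where this number is at least 4, so a
    block left alone has at most 3.  There the omitted point and the pairing can
    be chosen so that the surplus of the omitted point is made up inside the
    block: otherwise every choice admits a set of triples violating this, and
    comparing the violating sets before and after one exchange leads, by
    counting incidences modulo 3, to a contradiction. *)

(** * Hall's theorem *)

(** Induction on [#|A|], splitting at a tight nonempty proper subset if there is one. The point [y0]
    only supplies values when [A] is empty. *)
Lemma hall_marriage (X Y : finType) (y0 : Y) (r : X -> {set Y}) (A : {set X}) :
  (forall A' : {set X}, A' \subset A -> #|A'| <= #|\bigcup_(x in A') r x|) ->
  exists f : X -> Y, {in A &, injective f} /\ {in A, forall x, f x \in r x}.
Proof.
have [n] := ubnP #|A|; elim: n r A => // n IHn r A ltAn hallA.
have [->|[x0 x0A]] := set_0Vmem A.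
  by exists (fun=> y0); split=> [x1 x2|x1]; rewrite inE.
have [/existsP[A0 /and4P[sA0 nA0 pA0 tA0]]|] := boolP [exists A0 : {set X},
    [&& A0 \subset A, A0 != set0, A0 != A & #|\bigcup_(x in A0) r x| <= #|A0|]].
  set W := \bigcup_(x in A0) r x in tA0.
  have ltA0 : #|A0| < #|A| by rewrite proper_card // properEneq pA0.
  have [||f0 [inj0 in0]] := IHn r A0; first by lia.
    by move=> A' sA'; apply: hallA; apply: subset_trans sA' sA0.
  have card0 : 0 < #|A0| by rewrite card_gt0.
  have cardD := cardsD A A0; rewrite (setIidPr sA0) in cardD.
  (* As [A0] is tight, a subset of [A :\: A0] lacking points outside [W] would, joined with [A0],
     violate the condition on [A]. *)
  have [||f1 [inj1 in1]] := IHn (fun x => r x :\: W) (A :\: A0); first by lia.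
    move=> A' sA'.
    have dA : A' :&: A0 = set0.
      by apply/eqP; rewrite setI_eq0; move: sA'; rewrite subsetD => /andP[].
    have sU : A' :|: A0 \subset A.
      by rewrite subUset sA0 andbT; apply: subset_trans sA' (subsetDl _ _).
    have := hallA _ sU; rewrite cardsU dA cards0 subn0 => le1.
    have sub : \bigcup_(x in A' :|: A0) r x
        \subset W :|: \bigcup_(x in A') (r x :\: W).
      apply/bigcupsP => x; rewrite inE => /orP[xA|xA]; last first.
        by apply: subset_trans (subsetUl _ _); apply: (bigcup_sup x).
      apply/subsetP => y yr; rewrite inE; case: (boolP (y \in W)) => //= yW.
      by apply/bigcupP; exists x => //; rewrite inE yW.
    have := subset_leq_card sub.
    have := (leq_card_setU W (\bigcup_(x in A') (r x :\: W))).1.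
    by lia.
  exists (fun x => if x \in A0 then f0 x else f1 x); split.
    move=> x1 x2 x1A x2A.
    have inW x : x \in A0 -> f0 x \in W.
      by move=> xA; apply/bigcupP; exists x => //; apply: in0.
    have ninW x : x \in A -> x \notin A0 -> f1 x \notin W.
      move=> xA xA0; have /in1 : x \in A :\: A0 by rewrite inE xA0.
      by rewrite inE => /andP[].
    case: ifPn => x1A0; case: ifPn => x2A0 eqf.
    - exact: inj0.
    - by have := inW _ x1A0; rewrite eqf (negPf (ninW _ x2A x2A0)).
    - by have := inW _ x2A0; rewrite -eqf (negPf (ninW _ x1A x1A0)).
    - by apply: inj1 => //; rewrite inE ?x1A0 ?x2A0.
  move=> x xA /=; case: ifPn => xA0; first exact: in0.
  have /in1 : x \in A :\: A0 by rewrite inE xA0.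
  by rewrite inE => /andP[].
rewrite negb_exists => /forallP noTight.
(* Every nonempty proper subset now has a point to spare, so any [y1] in [r x0] may be given to
   [x0]. *)
have /card_gt0P[y1 y1r] : 0 < #|r x0|.
  by have := hallA [set x0]; rewrite sub1set x0A cards1 big_set1 => ->.
have cardD := cardsD1 x0 A; rewrite x0A in cardD.
have [||f [injf inf]] := IHn (fun x => r x :\ y1) (A :\ x0); first by lia.
  move=> A' sA'; have [->|nA'] := eqVneq A' set0; first by rewrite cards0.
  have sA'A : A' \subset A by apply: subset_trans sA' (subsetDl _ _).
  have x0A' : x0 \notin A' by apply/negP => /(subsetP sA'); rewrite !inE eqxx.
  have neA' : A' != A by apply: contraNneq x0A' => ->.
  have := noTight A'; rewrite sA'A nA' neA' /= -ltnNge => lt1.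
  have sub : \bigcup_(x in A') r x
      \subset y1 |: \bigcup_(x in A') (r x :\ y1).
    apply/bigcupsP => x xA; apply/subsetP => y yr; rewrite !inE.
    case: (eqVneq y y1) => //= ney.
    by apply/bigcupP; exists x => //; rewrite !inE ney.
  have := subset_leq_card sub.
  have := (leq_card_setU [set y1] (\bigcup_(x in A') (r x :\ y1))).1.
  by rewrite cards1; lia.
exists (fun x => if x == x0 then y1 else f x); split.
  move=> x1 x2 x1A x2A.
  have fy x : x \in A -> x != x0 -> f x != y1.
    move=> xA xn; have /inf : x \in A :\ x0 by rewrite !inE xn.
    by rewrite !inE => /andP[].
  case: eqVneq => [->|n1]; case: eqVneq => [->|n2] // eqf.
  - by have := fy _ x2A n2; rewrite -eqf eqxx.
  - by have := fy _ x1A n1; rewrite eqf eqxx.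
  - by apply: injf => //; rewrite !inE ?n1 ?n2.
move=> x xA /=; case: eqVneq => [->//|xn].
have /inf : x \in A :\ x0 by rewrite !inE xn.
by rewrite !inE => /andP[].
Qed.

(** * Triples *)

Section Triples.

Variables (I P : finType) (N : I -> {set P}).

Definition star (p : P) : {set I} := [set i | p \in N i].

Definition degIn (X : {set I}) (p : P) : nat := #|star p :&: X|.

Definition cov (X : {set I}) : {set P} := \bigcup_(i in X) N i.

Definition touch (i : I) (K : {set P}) : bool := N i :&: K != set0.

(** For a block [K] the points counted here lie in the barrier. With [X] full this is the number by
    which a block is costly (at least 4) or cheap (at most 3). *)
Definition excess (K : {set P}) (X : {set I}) : nat :=
  \sum_(i in X | touch i K) #|N i :\: K|.

(* [mu] pairs up the points of [C], and [own p] is a triple containing both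
   [p] and [mu p]. *)
Definition linked (C : {set P}) (mu : P -> P) (own : P -> I) : Prop :=
  {in C, forall p, [/\ mu p \in C, mu p != p, mu (mu p) = p,
                       own (mu p) = own p & p \in N (own p)]}.

Lemma touchP i (K : {set P}) : reflect (exists2 p, p \in N i & p \in K) (touch i K).
Proof.
apply: (iffP (set0Pn _)) => [[p]|[p pi pK]]; first by rewrite inE => /andP[]; exists p.
by exists p; rewrite inE pi.
Qed.

Lemma degIn_gt0 (X : {set I}) p : (0 < degIn X p) = (p \in cov X).
Proof.
apply/card_gt0P/bigcupP => [[i]|[i iX pi]].
  by rewrite !inE => /andP[pi iX]; exists i.
by exists i; rewrite !inE pi.
Qed.

Lemma sum_degIn (X : {set I}) (D : {set P}) :
  \sum_(p in D) degIn X p = \sum_(i in X) #|N i :&: D|.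
Proof.
transitivity (\sum_(p in D) \sum_(i in X) (p \in N i : nat)).
  apply: eq_bigr => p _; rewrite /degIn -sum1_card big_mkcond [RHS]big_mkcond.
  by apply: eq_bigr => i _; rewrite !inE; case: (p \in N i); case: (i \in X).
rewrite exchange_big; apply: eq_bigr => i _ /=.
rewrite -sum1_card big_mkcond [RHS]big_mkcond.
by apply: eq_bigr => p _; rewrite !inE; case: (p \in N i); case: (p \in D).
Qed.

Lemma degInD (X : {set I}) p : degIn X p + #|star p :\: X| = #|star p|.
Proof. by rewrite /degIn cardsID. Qed.

Lemma excess_sub K (X X' : {set I}) : X \subset X' -> excess K X <= excess K X'.
Proof.
move=> sX; rewrite /excess big_mkcond [leqRHS]big_mkcond leq_sum // => i _.
case: ifP => [/andP[iX ->]|//]; by rewrite (subsetP sX).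
Qed.

Lemma excess_gt0P (K : {set P}) (X : {set I}) :
  reflect (exists2 i, i \in X & touch i K && (0 < #|N i :\: K|))
          (0 < excess K X).
Proof.
rewrite lt0n /excess sum_nat_eq0.
apply: (iffP forallPn) => [[i]|[i iX /andP[ti gi]]]; last first.
  by exists i; rewrite iX ti -lt0n.
by rewrite negb_imply -lt0n => /andP[/andP[iX ti] gi]; exists i; rewrite ?ti.
Qed.

Lemma excessU1 (K : {set P}) (X : {set I}) i : i \in X -> touch i K ->
  excess K X = #|N i :\: K| + excess K (X :\ i).
Proof.
move=> iX ti; rewrite /excess (bigD1 i) ?iX //=; congr (_ + _).
by apply: eq_bigl => j; rewrite !inE; case: (j == i); rewrite ?andbF ?andbT.
Qed.

Hypothesis card_N : forall i, #|N i| = 3.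

(** A triple of [Z] that meets [K] contributes three, its points in [K] to the sum and the others to
    the excess; any other triple contributes nothing. *)
Lemma degIn_excess_mod3 (K D : {set P}) (Z : {set I}) :
    D \subset K -> (forall i, i \in Z -> N i :&: K \subset D) ->
  3 %| \sum_(p in D) degIn Z p + excess K Z.
Proof.
move=> sDK sZ; rewrite sum_degIn /excess big_mkcondr -big_split /=.
apply: dvdn_sum => i iZ.
have -> : N i :&: D = N i :&: K.
  apply/eqP; rewrite eqEsubset setIS //= subsetI subsetIl; exact: sZ.
have := cardsID K (N i); rewrite card_N.
case: ifPn => [_ -> //|]; rewrite /touch negbK => /eqP ->.
by rewrite cards0.
Qed.

End Triples.

(** * Blocks meeting few outside points *)

Lemma residue_one s d e : s + 1 = d * 3 -> 3 %| s + e -> e <= 2 -> e = 1.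
Proof. by lia. Qed.

Section Blocked.

Variables (I P : finType) (N : I -> {set P}).
Hypothesis card_N : forall i, #|N i| = 3.

Local Notation star := (star N).
Local Notation degIn := (degIn N).
Local Notation cov := (cov N).
Local Notation excess := (excess N).
Local Notation touch := (touch N).
Local Notation linked := (linked N).

Variable K : {set P}.

(* [X] exhibits the failure of the configuration that omits [k] from [K] and
   pairs up the other points inside the triples [own]. *)
Definition blocking (k : P) (own : P -> I) (X : {set I}) : Prop :=
  [/\ star k \subset X, {in K :\ k, forall y, own y \notin X} &
      {in K :\ k, forall y, y \in cov X -> star y :\: X = [set own y]}].

Lemma blocking_missing k own X y : blocking k own X -> y \in K -> y \in cov X ->
  star y :\: X = if y == k then set0 else [set own y].
Proof.
move=> [bk _ bX] yK yX; case: eqVneq => [->|nyk].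
  by apply/eqP; rewrite setD_eq0.
by apply: bX; rewrite // !inE nyk.
Qed.

(* The pair of [y] is given up for the pair [{k, y}] inside [x]; the new omitted
   point is the former partner of [y]. *)
Lemma linked_swap k x y mu own : k \in K -> y \in K :\ k ->
    k \in N x -> y \in N x -> linked (K :\ k) mu own ->
  linked (K :\ mu y)
    (fun z => if z == k then y else if z == y then k else mu z)
    (fun z => if (z == k) || (z == y) then x else own z).
Proof.
move=> kK yKk kx yx lk.
have [mK nmy mmy _ _] := lk _ yKk.
have nyk : y != k by move: yKk; rewrite !inE => /andP[].
have yK : y \in K by move: yKk; rewrite !inE => /andP[].
have nmk : mu y != k by move: mK; rewrite !inE => /andP[].
have nky : k != y by rewrite eq_sym.
have nkm : k != mu y by rewrite eq_sym.
have nym : y != mu y by rewrite eq_sym.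
move=> z; rewrite !inE => /andP[nzm zK].
have [->|nzk] := eqVneq z k.
  by rewrite (negPf nyk) !eqxx yK orbT nym kx.
have [->|nzy] := eqVneq z y.
  by rewrite !eqxx orbT kK nkm nky yx.
have zKk : z \in K :\ k by rewrite !inE nzk.
have [mzK nmz mmz oz zo] := lk _ zKk.
have nmzk : mu z != k by move: mzK; rewrite !inE => /andP[].
have nmzy : mu z != y by apply: contraNneq nzm => <-; rewrite mmz.
rewrite (negPf nmzk) (negPf nmzy) /= mmz oz zo nmz; split=> //.
move: mzK; rewrite !inE => /andP[_ ->]; rewrite andbT.
by apply: contraNneq nzy => e; rewrite -mmz e mmy.
Qed.

Hypothesis deg_K : {in K, forall y, #|star y| = 4}.
Hypothesis excess_K : excess K [set: I] <= 3.
Hypothesis near_linked :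
  {in K, forall v, exists mu own, linked (K :\ v) mu own}.
Hypothesis blocked : forall k mu own, k \in K -> linked (K :\ k) mu own ->
  exists X, blocking k own X.

Lemma excess_le3 X : excess K X <= 3.
Proof. exact: leq_trans (excess_sub _ _ (subsetT X)) excess_K. Qed.

(** Within [X] the point [k] has degree 4 and every other covered point of [K] degree 3, so the
    excess is 2 modulo 3, and it is at most 3. *)
Lemma blocking_excess k own X : k \in K -> blocking k own X -> excess K X = 2.
Proof.
move=> kK bX; have le3 := excess_le3 X.
pose D := K :&: cov X.
have := @degIn_excess_mod3 _ _ N card_N K D X (subsetIl _ _).
have kX : k \in cov X.
  rewrite -degIn_gt0 /degIn; case: bX => bk _ _.
  by rewrite (setIidPl bk) deg_K.
have -> : \sum_(p in D) degIn X p = \sum_(p in D) (3 + (p == k)).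
  apply: eq_bigr => p; rewrite inE => /andP[pK pX].
  have := degInD N X p; rewrite (blocking_missing bX pK pX) deg_K //.
  by case: eqVneq => _; rewrite ?cards0 ?cards1; lia.
rewrite big_split /= sum_nat_const (bigD1 k) ?inE ?kK ?kX //= eqxx.
rewrite big1 => [|p /andP[_ /negPf->]] // sZ.
have {sZ} : 3 %| #|D| * 3 + (1 + 0) + excess K X.
  by apply: sZ => i iX; rewrite setIC setIS //; apply: bigcup_sup iX.
by lia.
Qed.

(* What is known of a set [X'] blocking the configuration of [linked_swap], in
   terms of the old [own]; [m] is the new omitted point. *)
Variant rotated k own x y (X' : {set I}) : Prop :=
  Rotated m of [/\ m \in K, m != k, m != y & own m = own y]
    & own y \in X' & x \notin X' & y \in cov X'
    & forall z, z \in K -> z \in cov X' -> star z :\: X' =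
        if z == m then set0 else [set if (z == k) || (z == y) then x else own z].

(** The hypothesis [blocked] is applied to the configuration of [linked_swap]. The resulting set
    contains [own y], which passes through the new omitted point [mu y], and avoids [x], which has
    become an owner. *)
Lemma rotation k x y mu own : k \in K -> y \in K :\ k ->
    k \in N x -> y \in N x -> linked (K :\ k) mu own ->
  exists X', rotated k own x y X'.
Proof.
move=> kK yKk kx yx lk.
have [mK nmy _ omy yo] := lk _ yKk.
have [_ _ _ _ mo] := lk _ mK.
have mK' : mu y \in K by move: mK; rewrite !inE => /andP[].
have nmk : mu y != k by move: mK; rewrite !inE => /andP[].
have [X' bX] := blocked mK' (linked_swap kK yKk kx yx lk).
have oX : own y \in X'.
  by case: bX => /subsetP sX _ _; apply: sX; rewrite inE -omy.
exists X'; exists (mu y) => //.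
- have [_ avoid _] := bX; have := avoid k.
  by rewrite !inE eqxx kK eq_sym nmk => /(_ isT).
- by apply/bigcupP; exists (own y).
move=> z zK zX; rewrite (blocking_missing bX zK zX).
by case: ifP.
Qed.

Section Config.

Variables (k : P) (mu : P -> P) (own : P -> I) (X : {set I}).
Hypothesis kK : k \in K.
Hypothesis lk : linked (K :\ k) mu own.
Hypothesis bX : blocking k own X.

Lemma starX i : k \in N i -> i \in X.
Proof. by move=> ki; case: bX => /subsetP sX _ _; apply: sX; rewrite inE. Qed.

Lemma own_X y : y \in K :\ k -> own y \notin X.
Proof. by case: bX => _ h _; apply: h. Qed.

Lemma missing_X z : z \in K -> z \in cov X ->
  star z :\: X = if z == k then set0 else [set own z].
Proof. exact: blocking_missing. Qed.

(** A point of [K] covered by both sets has degree 3 in [X :&: X'], except [y], which loses both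
    [own y] and [x]. The excess is thus 1 modulo 3, and at most [excess K X = 2]. *)
Lemma rotation_excess x y X' : y \in K :\ k -> k \in N x -> y \in N x ->
  rotated k own x y X' -> excess K (X :&: X') = 1.
Proof.
move=> yKk kx yx [m [mK nmk nmy omy] oX xX yX' miss].
have xinX := starX kx.
have := yKk; rewrite !inE => /andP[nyk yK].
have yX : y \in cov X by apply/bigcupP; exists x.
have nox : own y != x by apply: contraTneq xinX => <-; apply: own_X.
pose D := K :&: (cov X :&: cov X').
have := @degIn_excess_mod3 _ _ N card_N K D (X :&: X') (subsetIl _ _).
have le2 : excess K (X :&: X') <= 2.
  by rewrite -(blocking_excess kK bX) excess_sub // subsetIl.
have : \sum_(p in D) (degIn (X :&: X') p + (p == y)) = \sum_(p in D) 3.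
  apply: eq_bigr => p; rewrite !inE => /and3P[pK pX pX'].
  have := degInD N (X :&: X') p; rewrite setDIr missing_X // miss // deg_K //.
  have [->|nky] := eqVneq p y.
    rewrite (negPf nyk) eq_sym (negPf nmy) orbT cards2.
    by rewrite nox ?eqxx addn1 addn2 => -[->].
  have [->|nkp] := eqVneq p k.
    by rewrite eq_sym (negPf nmk) set0U cards1 addn1 addn0 => -[->].
  by case: eqVneq => _; rewrite ?setU0 ?setUid cards1 addn1 addn0 => -[->].
have e1 : \sum_(p in D) (p == y) = 1.
  rewrite (bigD1 y) ?inE ?yK ?yX ?yX' //= eqxx big1 // => p.
  by case/andP=> _ /negPf->.
rewrite big_split /= e1 sum_nat_const => sD sZ.
have {sZ} : 3 %| \sum_(p in D) degIn (X :&: X') p + excess K (X :&: X').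
  apply: sZ => i; rewrite inE => /andP[iX iX']; rewrite setIC setIS //.
  by rewrite subsetI (bigcup_sup i) // (bigcup_sup i).
by move/(residue_one sD)/(_ le2).
Qed.

(* Every point of [K] covered by all three sets lies in exactly three triples of
   their intersection. *)
Lemma two_rotations_excess x1 y1 X1 x2 y2 X2 :
    k \in N x1 -> y1 \in N x1 -> y1 \in K :\ k -> rotated k own x1 y1 X1 ->
    k \in N x2 -> y2 \in N x2 -> y2 \in K :\ k -> rotated k own x2 y2 X2 ->
    y1 \notin cov X2 -> y2 \notin cov X1 ->
    (x1 == x2) || (k \notin cov X1) ->
  3 %| excess K (X :&: (X1 :&: X2)).
Proof.
move=> kx1 yx1 yK1 [m1 [mK1 nmk1 nmy1 omy1] oX1 xX1 yX1 miss1].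
move=> kx2 yx2 yK2 [m2 [mK2 nmk2 nmy2 omy2] oX2 xX2 yX2 miss2] ny12 ny21 ok.
have ny : y1 != y2 by apply: contraNneq ny12 => ->.
pose D := K :&: (cov X :&: (cov X1 :&: cov X2)).
have := @degIn_excess_mod3 _ _ N card_N K D (X :&: (X1 :&: X2)) (subsetIl _ _).
have -> : \sum_(p in D) degIn (X :&: (X1 :&: X2)) p = \sum_(p in D) 3.
  apply: eq_bigr => p; rewrite !inE => /and4P[pK pX pX1 pX2].
  have := degInD N (X :&: (X1 :&: X2)) p.
  rewrite !setDIr missing_X // miss1 // miss2 // deg_K //.
  have np1 : p != y1 by apply: contraNneq ny12 => <-.
  have np2 : p != y2 by apply: contraNneq ny21 => <-.
  rewrite (negPf np1) (negPf np2) !orbF.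
  (* The point [k] loses [x1] and [x2]; this is a single triple if they coincide, and otherwise [k]
     is not covered by [X1]. *)
  have [ep|npk] := eqVneq p k.
    have [e12|] := eqVneq x1 x2; last by move: ok; case: eqVneq; rewrite // -ep pX1.
    rewrite ep ![k == _]eq_sym (negPf nmk1) (negPf nmk2) e12 set0U setUid cards1.
    by rewrite addn1 => -[].
  by do 2!case: ifP => _; rewrite !(set0U, setU0, setUid) cards1 addn1 => -[].
rewrite sum_nat_const => sZ.
have {sZ} : 3 %| #|D| * 3 + excess K (X :&: (X1 :&: X2)).
  apply: sZ => i; rewrite !inE => /and3P[iX iX1 iX2]; rewrite setIC setIS //.
  by rewrite !subsetI !(bigcup_sup i).
by rewrite dvdn_addr // dvdn_mull.
Qed.

(** If [X'] covered [y], then [x] would be the one triple at [y] missing from [X']. It is not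
    [own y], because [x] contains [k] and so lies in [X]; and being the exchanged triple is excluded
    by the last hypothesis. *)
Lemma rotation_not_cov x y x' y' X' : k \in N x -> y \in N x -> y \in K :\ k ->
    rotated k own x' y' X' -> x \notin X' -> (y != y') || (x != x') ->
  y \notin cov X'.
Proof.
move=> kx yx yKk [m _ _ _ _ miss] xX' dif; apply/negP => yX'.
have := yKk; rewrite !inE => /andP[nyk yK].
have : x \in star y :\: X' by rewrite !inE xX'.
rewrite miss // (negPf nyk) /=; case: ifP => _; first by rewrite inE.
case: eqVneq dif => /= [_ nx|_ _]; rewrite inE => /eqP ex.
  by rewrite ex eqxx in nx.
by have := own_X yKk; rewrite -ex starX.
Qed.

Variable i0 : I.
Hypothesis ki0 : k \in N i0.
Hypothesis gt0_i0 : 0 < #|N i0 :\: K|.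

Lemma touch_k i : k \in N i -> touch i K.
Proof. by move=> ki; apply/touchP; exists k. Qed.

(** Exchange along [x] with either of its two other points. If both blocking sets covered [k], both
    would contain [i0], since at [k] they miss only [x]. The intersection with [X] would then have
    excess 1 or 2, against divisibility by 3. *)
Lemma rotation_avoiding x : k \in N x -> N x \subset K ->
  exists y X', [/\ y \in K :\ k, y \in N x, rotated k own x y X' & k \notin cov X'].
Proof.
move=> kx sxK.
have nx0 : i0 != x.
  by apply: contraTneq gt0_i0 => ->; rewrite -leqNgt leqn0 cards_eq0 setD_eq0.
have : #|N x :\ k| == 2 by have := cardsD1 k (N x); rewrite card_N kx; lia.
case/cards2P => y [w [nyw eyw]].
have sub z : z \in [set y; w] -> z \in K :\ k /\ z \in N x.
  by rewrite -eyw !inE => /andP[-> zx]; rewrite zx (subsetP sxK).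
have [yKk yx] := sub y (set21 _ _); have [wKk wx] := sub w (set22 _ _).
have [Xy rXy] := rotation kK yKk kx yx lk.
have [Xw rXw] := rotation kK wKk kx wx lk.
have [kXy|kXy] := boolP (k \in cov Xy); last by exists y, Xy.
have [kXw|kXw] := boolP (k \in cov Xw); last by exists w, Xw.
have in_rot z X' : rotated k own x z X' -> k \in cov X' -> i0 \in X'.
  case=> m [mK nmk _ _] _ _ _ miss kX'; apply: contraT => nX'.
  have : i0 \in star k :\: X' by rewrite !inE nX'.
  by rewrite miss // eq_sym (negPf nmk) eqxx /= inE (negPf nx0).
have nyw' : y \notin cov Xw.
  by apply: (rotation_not_cov kx yx yKk rXw) => //; [case: rXw | rewrite nyw].
have nwy' : w \notin cov Xy.
  apply: (rotation_not_cov kx wx wKk rXy) => //; first by case: rXy.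
  by rewrite eq_sym nyw.
have := two_rotations_excess kx yx yKk rXy kx wx wKk rXw nyw' nwy'.
rewrite eqxx => /(_ isT).
have : excess K (X :&: (Xy :&: Xw)) <= 2.
  by rewrite -(blocking_excess kK bX) excess_sub // subsetIl.
have : 0 < excess K (X :&: (Xy :&: Xw)).
  apply/excess_gt0P; exists i0; last by rewrite touch_k.
  by rewrite !inE starX // (in_rot _ _ rXy) // (in_rot _ _ rXw).
by case: (excess K _) => [|[|[|]]].
Qed.

(** Two exchanges along different triples through [k], both leaving [k] uncovered, are played
    against each other: the common intersection with [X] has excess divisible by 3 and at most 2,
    yet it turns out to be positive. *)
Lemma config_contradiction : False.
Proof.
have eX := blocking_excess kK bX.
have sumk : \sum_(i in star k) #|N i :\: K| <= 2.
  rewrite -eX /excess [leqLHS]big_mkcond [leqRHS]big_mkcond leq_sum // => i _ /=.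
  by case: ifP => //; rewrite inE => ki; rewrite starX // touch_k.
(* All four triples at [k] lie in [X], and those leaving [K] use up an excess of only 2. *)
have : 1 < #|[set i in star k | N i \subset K]|.
  have : \sum_(i in star k) (N i \subset K) + \sum_(i in star k) #|N i :\: K|
      >= #|star k|.
    rewrite -big_split -sum1_card leq_sum // => i _ /=.
    by case: (boolP (_ \subset _)) => //; rewrite -setD_eq0 -card_gt0.
  rewrite deg_K // -sum1_card => le4.
  have -> : \sum_(i in [set i in star k | N i \subset K]) 1
     = \sum_(i in star k) (N i \subset K).
    rewrite big_mkcond [RHS]big_mkcond; apply: eq_bigr => i _.
    by rewrite !inE; case: (k \in _); case: (_ \subset _).
  by rewrite -(leq_add2r 2); apply: leq_trans le4 _; rewrite leq_add2l.
case/card_gt1P => x1 [x2 []]; rewrite !inE => /andP[kx1 sx1] /andP[kx2 sx2] nx.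
have [y1 [X1 [yK1 yx1 r1 kX1]]] := rotation_avoiding kx1 sx1.
have [y2 [X2 [yK2 yx2 r2 kX2]]] := rotation_avoiding kx2 sx2.
have notin i X' : k \in N i -> k \notin cov X' -> i \notin X'.
  by move=> ki; apply: contra => iX'; apply/bigcupP; exists i.
have ny12 : y1 \notin cov X2.
  by apply: (rotation_not_cov kx1 yx1 yK1 r2) => //; rewrite ?notin // nx orbT.
have ny21 : y2 \notin cov X1.
  apply: (rotation_not_cov kx2 yx2 yK2 r1) => //; rewrite ?notin //.
  by rewrite [x2 == _]eq_sym nx orbT.
have := two_rotations_excess kx1 yx1 yK1 r1 kx2 yx2 yK2 r2 ny12 ny21.
rewrite kX1 orbT => /(_ isT).
have : excess K (X :&: (X1 :&: X2)) <= 2 by rewrite -eX excess_sub // subsetIl.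
suff : 0 < excess K (X :&: (X1 :&: X2)) by case: (excess K _) => [|[|[|]]].
have /excess_gt0P[j1] : 0 < excess K (X :&: X1).
  by rewrite (rotation_excess yK1 kx1 yx1 r1).
rewrite inE => /andP[j1X jX1] /andP[tj1 gj1].
have /excess_gt0P[j2] : 0 < excess K (X :&: X2).
  by rewrite (rotation_excess yK2 kx2 yx2 r2).
rewrite inE => /andP[j2X jX2] /andP[tj2 gj2].
have ni1 : i0 != j1 by apply: contraNneq (notin _ _ ki0 kX1) => ->.
have ni2 : i0 != j2 by apply: contraNneq (notin _ _ ki0 kX2) => ->.
(* Equal triples give the intersection positive excess. Otherwise [i0], [j1] and [j2] are three
   triples of [X] that leave [K], against [excess K X = 2]. *)
have [e12|n12] := eqVneq j1 j2.
  by apply/excess_gt0P; exists j1; rewrite ?tj1 // !inE j1X jX1 e12.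
have j1' : j1 \in X :\ i0 by rewrite !inE eq_sym ni1.
have j2' : j2 \in X :\ i0 :\ j1 by rewrite !inE eq_sym n12 eq_sym ni2.
have := eX; rewrite (excessU1 (starX ki0) (touch_k ki0)).
rewrite (excessU1 j1' tj1) (excessU1 j2' tj2) => e2.
have : 3 <= 2 by rewrite -[X in _ <= X]e2 !addnA -[3]/(1 + 1 + 1 + 0) !leq_add.
by [].
Qed.

End Config.
(** A blocking set for an arbitrary omitted point has excess 2, hence contains a triple that meets
    [K] and leaves it. A point of [K] on that triple is the right one to omit. *)
Lemma not_all_blocked : K = set0.
Proof.
have [//|[k1 k1K]] := set_0Vmem K.
have [mu1 [own1 l1]] := near_linked k1K; have [X1 b1] := blocked k1K l1.
have /excess_gt0P[i0 _ /andP[/touchP[k ki0 kK] gi0]] : 0 < excess K X1.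
  by rewrite (blocking_excess k1K b1).
have [mu [own lk]] := near_linked kK; have [X bX] := blocked kK lk.
by case: (config_contradiction kK lk bX ki0 gi0).
Qed.

End Blocked.

(** * Choosing the omitted point of a cheap block *)

Section Cheap.

Variables (I P : finType) (N : I -> {set P}).
Hypothesis card_N : forall i, #|N i| = 3.
Hypothesis deg_N : forall p, #|star N p| <= 4.

Lemma degIn_le (X : {set I}) p : degIn N X p <= #|star N p|.
Proof. exact: subset_leq_card (subsetIl _ _). Qed.

Lemma degIn_avoid i (X : {set I}) p : p \in N i -> i \notin X -> degIn N X p <= 3.
Proof.
move=> pi iX; have := degInD N X p; have := deg_N p.
have : 0 < #|star N p :\: X| by apply/card_gt0P; exists i; rewrite !inE iX.
by lia.
Qed.

(* The two sides of Hall's condition for [X], restricted to the points of [A]. *)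
Definition balanced (A : {set P}) (X : {set I}) : Prop :=
  \sum_(p in A) degIn N X p <= 3 * #|A :&: cov N X|.

Lemma balanced_le3 (A : {set P}) (X : {set I}) :
  {in A, forall p, degIn N X p <= 3} -> balanced A X.
Proof.
move=> le3; rewrite /balanced mulnC -sum_nat_const big_mkcond.
rewrite [leqRHS]big_mkcond leq_sum // => p _; rewrite inE -degIn_gt0.
by case: (boolP (p \in A)) => //= /le3; case: (degIn N X p).
Qed.

(** A paired point loses its owner, so only [k] can have degree above 3 in [X]. Imbalance forces
    degree 4 there, and a covered point of degree below 3 would make up for this surplus of one. *)
Lemma unbalanced_blocking (K : {set P}) mu own k (X : {set I}) : k \in K ->
    linked N (K :\ k) mu own -> {in K :\ k, forall y, own y \notin X} ->
    ~ balanced K X ->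
  blocking N K k own X.
Proof.
move=> kK lk avoid unb.
have le3 y : y \in K :\ k -> degIn N X y <= 3 * (y \in cov N X).
  move=> yK; have [_ _ _ _ yo] := lk _ yK.
  have := degIn_avoid yo (avoid _ yK); rewrite -degIn_gt0.
  by case: (degIn N X y).
have sumE : \sum_(p in K) 3 * (p \in cov N X) = 3 * #|K :&: cov N X|.
  rewrite -big_distrr /= -sum1_card big_mkcond [in RHS]big_mkcond.
  congr (_ * _); apply: eq_bigr => p _; rewrite inE.
  by case: (p \in K); case: (p \in cov N X).
have kgt : 3 * (k \in cov N X) < degIn N X k.
  rewrite ltnNge; apply/negP => lek; apply: unb; rewrite /balanced -sumE.
  rewrite leq_sum // => p pK; have [->//|npk] := eqVneq p k.
  by apply: le3; rewrite !inE npk.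
have k4 : degIn N X k = 4 /\ k \in cov N X.
  move: kgt; rewrite -degIn_gt0; have := degIn_le X k; have := deg_N k.
  by case: (degIn N X k) => [|n] /=; lia.
case: k4 => k4 kX; split=> //.
  have := degInD N X k; have := deg_N k; rewrite k4 => ? ?.
  by rewrite -setD_eq0 -cards_eq0; lia.
move=> y yK yX; have [_ _ _ _ yo] := lk _ yK.
have oy : own y \in star N y :\: X by rewrite !inE avoid.
apply/eqP; rewrite eq_sym eqEcard sub1set oy cards1.
have yk : y != k by move: yK; rewrite !inE => /andP[].
have yK' : y \in K by move: yK; rewrite !inE => /andP[].
suff : 3 <= degIn N X y by have := degInD N X y; have := deg_N y; lia.
rewrite leqNgt; apply/negP => lt3; apply: unb; rewrite /balanced -sumE.
rewrite (bigD1 k) // (bigD1 y) ?yK' //= [leqRHS](bigD1 k) //.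
rewrite [X in _ <= _ + X](bigD1 y) ?yK' //= k4 kX yX.
suff : \sum_(i in K | (i != k) && (i != y)) degIn N X i <=
   \sum_(i in K | (i != k) && (i != y)) 3 * (i \in cov N X).
  rewrite (eq_bigl (fun i => (i \in K) && (i != k) && (i != y))); last first.
    by move=> i; rewrite andbA.
  rewrite [leqRHS](eq_bigl (fun i => (i \in K) && (i != k) && (i != y))); last first.
    by move=> i; rewrite andbA.
  by lia.
by rewrite leq_sum // => p /and3P[pK npk _]; apply: le3; rewrite !inE npk.
Qed.

(** A point of degree at most 3 can be omitted at once. If all degrees are 4, failure of every
    choice would make every configuration blocked, which [not_all_blocked] excludes. *)
Lemma cheap_block_choice (K : {set P}) :
    K != set0 -> excess N K [set: I] <= 3 ->
    {in K, forall v, exists mu own, linked N (K :\ v) mu own} ->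
  exists k mu own, [/\ k \in K, linked N (K :\ k) mu own &
    forall X : {set I}, {in K :\ k, forall y, own y \notin X} -> balanced K X].
Proof.
move=> nK cK fc.
have [/existsP[k /andP[kK lek]]|] := boolP [exists k in K, #|star N k| <= 3].
  have [mu [own lk]] := fc _ kK; exists k, mu, own; split=> // X avoid.
  apply: balanced_le3 => p pK; have [->|npk] := eqVneq p k.
    exact: leq_trans (degIn_le X k) lek.
  have pKk : p \in K :\ k by rewrite !inE npk.
  by have [_ _ _ _ /degIn_avoid] := lk _ pKk; apply; apply: avoid.
rewrite negb_exists => /forallP gt3; apply: NNPP => none.
case/eqP: nK; apply: (not_all_blocked card_N _ cK fc) => [y yK|k mu own kK lk].
  by have := gt3 y; rewrite yK -ltnNge /=; have := deg_N y; lia.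
apply: NNPP => noX; apply: none; exists k, mu, own; split=> // X avoid.
apply: NNPP => unb; apply: noX; exists X.
exact: unbalanced_blocking lk avoid unb.
Qed.

End Cheap.

(** * Barriers *)

Section Barrier.

Variables (I P : finType) (N : I -> {set P}) (i0 : I).

Local Notation touch := (touch N).
Local Notation linked := (linked N).

Lemma linked_pair (C : {set P}) mu own p q i : p \notin C -> q \notin C -> p != q ->
    p \in N i -> q \in N i -> linked C mu own ->
  linked (p |: (q |: C))
    (fun z => if z == p then q else if z == q then p else mu z)
    (fun z => if (z == p) || (z == q) then i else own z).
Proof.
move=> pC qC npq pi qi lC z.
have nqp : q != p by rewrite eq_sym.
rewrite 2!in_setU1; have [->|nzp] := eqVneq z p => /= [_|].
  by rewrite !inE !eqxx (negPf nqp) ?orbT.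
have [->|nzq] := eqVneq z q => /= [_|zC].
  by rewrite !inE !eqxx.
have [mC nmz mmz oz zo] := lC _ zC.
have nmp : mu z != p by apply: contraNneq pC => <-.
have nmq : mu z != q by apply: contraNneq qC => <-.
by rewrite !inE mC (negPf nmp) (negPf nmq) /= ?orbT.
Qed.

Lemma linked_glue (J : finType) (label : P -> J) (Q : {set J})
    (C : J -> {set P}) mu own :
    {in Q, forall j, linked (C j) (mu j) (own j)} ->
    {in Q, forall j, {in C j, forall p, label p = j}} ->
  linked (\bigcup_(j in Q) C j)
    (fun p => mu (label p) p) (fun p => own (label p) p).
Proof.
move=> lC labC p /bigcupP[j jQ pC]; rewrite (labC _ jQ _ pC).
have [mC nm mm om po] := lC _ jQ _ pC.
rewrite (labC _ jQ _ mC); split=> //.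
by apply/bigcupP; exists j.
Qed.

Definition linkable (C : {set P}) : Prop := exists mu own, linked C mu own.

Definition adjacent (B K : {set P}) : bool := [exists i, touch i K && touch i B].

Lemma linkable_setU1 (K : {set P}) b : {in K, forall v, linkable (K :\ v)} ->
  b \notin K -> adjacent [set b] K -> linkable (b |: K).
Proof.
move=> fc bK /existsP[i /andP[/touchP[k ki kK] /touchP[c ci /set1P cb]]].
rewrite {c}cb in ci; have [mu [own lk]] := fc _ kK.
have bKk : b \notin K :\ k by rewrite !inE (negPf bK) andbF.
have kKk : k \notin K :\ k by rewrite !inE eqxx.
have nbk : b != k by apply: contraNneq bK => ->.
have := linked_pair bKk kKk nbk ci ki lk; rewrite setD1K // => l2.
by do 2!eexists; apply: l2.
Qed.

Lemma linkable_glue (J : finType) (label : P -> J) (Q : {set J}) (A : {set P}) :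
    {in A, forall p, label p \in Q} ->
    {in Q, forall j, linkable [set p in A | label p == j]} ->
  linkable A.
Proof.
move=> labQ lC.
have [mo mo_lk] : exists mo : J -> (P -> P) * (P -> I), forall j, j \in Q ->
    linked [set p in A | label p == j] (mo j).1 (mo j).2.
  apply: (@fin_all_exists _ _ (fun j (mo : (P -> P) * (P -> I)) =>
     j \in Q -> linked [set p in A | label p == j] mo.1 mo.2)) => j.
  have [/lC[mu [own lk]]|jQ] := boolP (j \in Q); first by exists (mu, own).
  by exists (id, fun=> i0).
have labC : {in Q, forall j, {in [set p in A | label p == j], forall p, label p = j}}.
  by move=> j _ p; rewrite inE => /andP[_ /eqP].
have := linked_glue mo_lk labC; rewrite (_ : \bigcup_(j in Q) _ = A) => [lA|].
  by do 2!eexists; apply: lA.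
apply/setP => p; apply/bigcupP/idP => [[j _]|pA]; first by rewrite inE => /andP[].
by exists (label p); rewrite ?labQ // inE pA eqxx.
Qed.

(** As in the Tutte-Berge formula, [c.1] is deleted and [c.2] consists of odd parts of the rest,
    which triples connect, within [A], to [c.1] only. The parts need not exhaust [A :\: c.1]; the
    extremal choice in [barrier_structure] achieves that. *)
Definition barrier (A : {set P}) (c : {set P} * {set {set P}}) : bool :=
  [&& c.1 \subset A, trivIset c.2 &
      [forall K in c.2, [&& K \subset A :\: c.1, odd #|K| &
        [forall i, touch i K ==> (N i :&: A \subset K :|: c.1)]]]].

Lemma barrierP (A B : {set P}) (Q : {set {set P}}) :
  reflect [/\ B \subset A, trivIset Q & {in Q, forall K : {set P},
             [/\ K \subset A :\: B, odd #|K| &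
                 forall i, touch i K -> N i :&: A \subset K :|: B]}]
          (barrier A (B, Q)).
Proof.
apply: (iffP and3P) => [[sB tQ /forall_inP h]|[sB tQ h]].
  split=> // K /h /and3P[sK oK /forallP hK]; split=> // i ti.
  by have := hK i; rewrite ti.
split=> //; apply/forall_inP => K /h[-> -> hK] /=; apply/forallP => i.
by apply/implyP; apply: hK.
Qed.

(* The lexicographic order on [(#|Q| - #|B|, #|B|)]. *)
Definition score (c : {set P} * {set {set P}}) : nat :=
  (#|c.2| + #|P| - #|c.1|) * #|P|.+1 + #|c.1|.

Lemma score_lt (B B' : {set P}) (Q Q' : {set {set P}}) :
    (#|Q| + #|B'| < #|Q'| + #|B|) ||
    ((#|Q| + #|B'| == #|Q'| + #|B|) && (#|B| < #|B'|)) ->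
  score (B, Q) < score (B', Q').
Proof.
rewrite /score /= => h; have := max_card B; have := max_card B'.
move: h; move: #|Q| #|Q'| #|B| #|B'| #|P| => q q' b b' n h le' le.
have [[-> ltb]|lt] : q + n - b = q' + n - b' /\ b < b' \/ q + n - b < q' + n - b'.
- by lia.
- by rewrite ltn_add2l.
have : (q + n - b).+1 * n.+1 <= (q' + n - b') * n.+1 by rewrite leq_mul2r lt orbT.
by rewrite mulSn; lia.
Qed.

Lemma odd_blocks (Q : {set {set P}}) : trivIset Q ->
  {in Q, forall K : {set P}, odd #|K|} -> ~~ odd (#|cover Q| + #|Q|).
Proof.
move=> tQ oQ; have := tQ; rewrite /trivIset => /eqP <-.
rewrite -sum1_card -big_split /= -dvdn2; apply: dvdn_sum => K /oQ.
by rewrite dvdn2 addn1 /= negbK.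
Qed.

End Barrier.

(** * Existence of a barrier with near-linkable blocks *)

Section Structure.

Variables (I P : finType) (N : I -> {set P}) (i0 : I).

Local Notation touch := (touch N).
Local Notation linkable := (linkable N).
Local Notation barrier := (barrier N).
Local Notation adjacent := (adjacent N).

(** With [f] a matching of [B] into the blocks, each class of this labelling is a block, enlarged by
    the barrier point matched to it if there is one. *)
Definition block_label (B : {set P}) (Q : {set {set P}}) (f : P -> {set P}) p :=
  if p \in B then f p else pblock Q p.

Section Label.

Variables (A B : {set P}) (Q : {set {set P}}) (f : P -> {set P}).
Hypotheses (sBA : B \subset A) (trivQ : trivIset Q) (covQ : cover Q = A :\: B).
Hypotheses (inj_f : {in B &, injective f}) (fQ : {in B, forall b, f b \in Q}).

Lemma block_label_in p : p \in A -> block_label B Q f p \in Q.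
Proof.
move=> pA; rewrite /block_label; case: ifPn => pB; first exact: fQ.
by rewrite pblock_mem // covQ inE pB.
Qed.

Lemma block_label_out K p : K \in Q -> p \notin B ->
  (p \in A) && (block_label B Q f p == K) = (p \in K).
Proof.
move=> KQ pB; rewrite /block_label (negPf pB).
apply/andP/idP => [[pA /eqP <-]|pK].
  by rewrite mem_pblock covQ inE pB.
have : p \in cover Q by apply/bigcupP; exists K.
by rewrite covQ inE => /andP[_ ->]; rewrite (def_pblock _ KQ).
Qed.

Lemma block_label_disjoint K b : K \in Q -> b \in B -> b \notin K.
Proof.
move=> KQ bB; apply/negP => bK.
have : b \in cover Q by apply/bigcupP; exists K.
by rewrite covQ inE bB.
Qed.

Lemma block_label_paired b : b \in B ->
  [set p in A | block_label B Q f p == f b] = b |: f b.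
Proof.
move=> bB; apply/setP => p; rewrite !inE.
have [pB|pB] := boolP (p \in B); last first.
  rewrite block_label_out ?fQ //.
  by case: eqVneq => // e; rewrite e bB in pB.
rewrite /block_label pB (subsetP sBA) //= (negPf (block_label_disjoint (fQ bB) pB)).
by rewrite orbF; apply/eqP/eqP => [/inj_f->|->].
Qed.

Lemma block_label_unpaired K : K \in Q -> {in B, forall b, f b != K} ->
  [set p in A | block_label B Q f p == K] = K.
Proof.
move=> KQ nfK; apply/setP => p; rewrite !inE.
have [pB|pB] := boolP (p \in B); last by rewrite block_label_out.
rewrite /block_label pB (negPf (nfK _ pB)) andbF.
by rewrite (negPf (block_label_disjoint KQ pB)).
Qed.

End Label.

Definition hall_blocks (B : {set P}) (Q : {set {set P}}) : Prop :=
  forall B' : {set P}, B' \subset B -> #|B'| <= #|[set K in Q | adjacent B' K]|.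

Lemma adjacent_bigcup (B : {set P}) (Q : {set {set P}}) :
  \bigcup_(b in B) [set K in Q | adjacent [set b] K] = [set K in Q | adjacent B K].
Proof.
apply/setP => K; apply/bigcupP/idP => [[b bB]|]; rewrite !inE.
  case/andP=> -> /existsP[i /andP[tK /touchP[c ci /set1P e]]].
  by apply/existsP; exists i; rewrite tK; apply/touchP; exists b; rewrite // -e.
case/andP=> KQ /existsP[i /andP[tK /touchP[b bi bB]]]; exists b => //.
rewrite inE KQ; apply/existsP; exists i; rewrite tK.
by apply/touchP; exists b; rewrite ?inE.
Qed.

(** By [#|Q| <= #|B|] Hall's matching of [B] into [Q] is onto. Each block thus receives a barrier
    point, which is paired with a point of the block, and the rest of the block is linkable. *)
Lemma linkable_of_hall A B Q : barrier A (B, Q) -> cover Q = A :\: B ->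
    {in Q, forall K : {set P}, {in K, forall v, linkable (K :\ v)}} ->
    hall_blocks B Q -> #|Q| <= #|B| ->
  linkable A.
Proof.
move=> /barrierP[sBA tQ bQ] cQ fc hB leQB.
have [|f [inj_f adj_f]] :=
  @hall_marriage _ _ set0 (fun b => [set K in Q | adjacent [set b] K]) B.
  by move=> B' sB'; rewrite adjacent_bigcup; apply: hB.
have fQ : {in B, forall b, f b \in Q} by move=> b /adj_f; rewrite inE => /andP[].
apply: (@linkable_glue _ _ N i0 _ (block_label B Q f) Q) => [p pA|K KQ].
  exact: block_label_in cQ fQ _ pA.
have /imsetP[b bB eK] : K \in f @: B.
  suff -> : f @: B = Q by [].
  apply/eqP; rewrite eqEcard card_in_imset // leQB andbT.
  by apply/subsetP => _ /imsetP[b bB ->]; apply: fQ.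
rewrite eK (block_label_paired sBA tQ cQ inj_f fQ bB).
apply: linkable_setU1; rewrite -?eK; first exact: fc.
  exact: (block_label_disjoint cQ KQ bB).
by have := adj_f _ bB; rewrite inE -eK KQ.
Qed.

(** The block [K] is refined by a barrier of [K :\ v]: triples leaving a new block inside [K] end in
    [B], in [B'] or at [v]. *)
Lemma barrier_split A B Q K v B' Q' : barrier A (B, Q) -> K \in Q -> v \in K ->
    barrier (K :\ v) (B', Q') ->
  [/\ barrier A (B :|: (v |: B'), (Q :\ K) :|: Q'),
      #|B :|: (v |: B')| = #|B| + #|B'|.+1 &
      #|(Q :\ K) :|: Q'| + 1 = #|Q| + #|Q'|].
Proof.
move=> /barrierP[sBA tQ bQ] KQ vK /barrierP[sB' tQ' bQ'].
have [sK oK clK] := bQ _ KQ.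
have disjQ L : L \in Q -> L != K -> [disjoint L & K].
  by move=> LQ nLK; apply: (trivIsetP tQ).
have sQ'K L : L \in Q' -> L \subset K :\ v.
  by move=> LQ'; have [s _ _] := bQ' _ LQ'; apply: subset_trans s (subsetDl _ _).
have n0Q' L : L \in Q' -> exists2 p, p \in L & p \in K.
  move=> LQ'; have [_ oL _] := bQ' _ LQ'.
  have /card_gt0P[p pL] : 0 < #|L| by case: #|L| oL.
  by exists p; rewrite // (subsetP (subsetDl _ _) _ (subsetP (sQ'K _ LQ') _ pL)).
have vB : v \notin B by have := subsetP sK _ vK; rewrite inE => /andP[].
have vB' : v \notin B' by apply/negP => /(subsetP sB'); rewrite !inE eqxx.
have KB p : p \in K -> p \notin B.
  by move=> pK; have := subsetP sK _ pK; rewrite inE => /andP[].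
have KA p : p \in K -> p \in A.
  by move=> pK; have := subsetP sK _ pK; rewrite inE => /andP[].
have B'K p : p \in B' -> p \in K.
  by move=> /(subsetP sB'); rewrite inE => /andP[].
split; first apply/barrierP; first split.
- rewrite !subUset sBA sub1set KA //=.
  by apply/subsetP => p /B'K/KA.
- apply/trivIsetP => L1 L2; rewrite !inE.
  case/orP=> [/andP[n1 L1Q]|L1Q']; case/orP=> [/andP[n2 L2Q]|L2Q'] nL.
  + exact: (trivIsetP tQ).
  + apply: disjointWr (disjQ _ L1Q n1).
    by apply: subset_trans (sQ'K _ L2Q') (subsetDl _ _).
  + rewrite disjoint_sym; apply: disjointWr (disjQ _ L2Q n2).
    by apply: subset_trans (sQ'K _ L1Q') (subsetDl _ _).
  + exact: (trivIsetP tQ').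
- move=> L; rewrite !inE => /orP[/andP[nLK LQ]|LQ'].
    have [sL oL clL] := bQ _ LQ; split=> // [|i ti].
      apply/subsetP => p pL; have := subsetP sL _ pL; rewrite !inE.
      have pK : p \notin K by have := disjointFr (disjQ _ LQ nLK) pL => ->.
      case/andP=> /negPf-> ->; rewrite andbT orFb negb_or.
      by rewrite (contraNneq _ pK) => [|->]; rewrite ?(contra (@B'K p)).
    by apply: subset_trans (clL _ ti) _; rewrite setUA subsetUl.
  have [sL oL clL] := bQ' _ LQ'; split=> // [|i ti].
    apply/subsetP => p pL; have := subsetP sL _ pL; rewrite !inE.
    by case/and3P=> /negPf-> /negPf-> pK; rewrite KA // (negPf (KB _ pK)).
  have [p pi pL] := touchP _ _ _ ti.
  have tiK : touch i K.
    apply/touchP; exists p => //.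
    exact: subsetP (subsetDl _ _) _ (subsetP (sQ'K _ LQ') _ pL).
  apply/subsetP => q qiA; have := subsetP (clK _ tiK) _ qiA; rewrite !inE.
  case/orP=> [qK|->]; last by rewrite orbT.
  have [->|nqv] := eqVneq q v; first by rewrite !orbT.
  have : q \in N i :&: (K :\ v).
    by rewrite !inE nqv qK; move: qiA; rewrite inE => /andP[->].
  by move/(subsetP (clL _ ti)); rewrite inE => /orP[->|->]; rewrite ?orbT.
- rewrite cardsU (_ : B :&: _ = set0) ?cards0 ?subn0 ?cardsU1 ?vB' //.
  apply/setP => p; rewrite !inE; apply/negP => /andP[pB /orP[/eqP e|/B'K/KB]].
    by rewrite e (negPf vB) in pB.
  by rewrite pB.
rewrite cardsU (_ : _ :&: Q' = set0) ?cards0 ?subn0.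
  by rewrite (cardsD1 K Q) KQ addn1 addSn.
apply/setP => L; rewrite !inE; apply/negP => /andP[/andP[nLK LQ] LQ'].
by have [p pL pK] := n0Q' _ LQ'; have := disjointFr (disjQ _ LQ nLK) pL; rewrite pK.
Qed.

(** The surviving blocks share no triple with [B'], so they stay closed without it. *)
Lemma barrier_remove A (B : {set P}) Q (B' : {set P}) : barrier A (B, Q) -> B' \subset B ->
  barrier A (B :\: B', Q :\: [set K in Q | adjacent B' K]).
Proof.
move=> /barrierP[sBA tQ bQ] sB'; apply/barrierP; split.
- exact: subset_trans (subsetDl _ _) sBA.
- by apply: trivIsetS tQ; apply: subsetDl.
move=> K; rewrite !inE => /andP[nadj KQ]; rewrite KQ /= in nadj.
have [sK oK clK] := bQ _ KQ; split=> // [|i ti].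
  by apply: subset_trans sK _; rewrite setDS // subsetDl.
apply/subsetP => p piA; have := subsetP (clK _ ti) _ piA; rewrite !inE.
case/orP=> [->//|pB]; rewrite pB andbT; apply/orP; right.
apply: contra nadj => pB'; apply/existsP; exists i; rewrite ti.
by apply/touchP; exists p => //; move: piA; rewrite inE => /andP[].
Qed.

(** No triple joins the uncovered rest [R] to a block, so [R] is a new block if it is odd; if it is
    even, moving [v] to the barrier makes it odd. *)
Lemma barrier_add (A B R : {set P}) Q v : barrier A (B, Q) ->
    R = A :\: B :\: cover Q -> v \in R ->
  barrier A (if odd #|R| then (B, R |: Q) else (v |: B, (R :\ v) |: Q)).
Proof.
move=> /barrierP[sBA tQ bQ] defR vR.
have inR p : (p \in R) = [&& p \notin cover Q, p \notin B & p \in A].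
  by rewrite defR !inE.
have dR (L K : {set P}) : L \subset R -> K \in Q -> [disjoint L & K].
  move=> sL KQ; apply/pred0P => p /=; apply/negP => /andP[/(subsetP sL)].
  by rewrite inR => /andP[pc _] pK; case/negP: pc; apply/bigcupP; exists K.
have triv (L : {set P}) : L \subset R -> trivIset (L |: Q).
  move=> sL; apply/trivIsetP => L1 L2; rewrite !inE.
  case/orP=> [/eqP->|Q1]; case/orP=> [/eqP->|Q2]; rewrite ?eqxx //.
  - by move=> _; apply: dR.
  - by move=> _; rewrite disjoint_sym; apply: dR.
  - exact: (trivIsetP tQ).
have clR i : touch i R -> N i :&: A \subset R :|: B.
  case/touchP => p pi; rewrite inR => /and3P[pc pB pA].
  apply/subsetP => q; rewrite inE => /andP[qi qA]; rewrite inE inR qA andbT.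
  have [qB|qB] := boolP (q \in B); rewrite ?orbT // andbT orbF.
  apply/negP => /bigcupP[K KQ qK]; have [_ _ clK] := bQ _ KQ.
  have ti : touch i K by apply/touchP; exists q.
  have /(subsetP (clK _ ti)) : p \in N i :&: A by rewrite inE pi.
  rewrite inE (negPf pB) orbF => pK; case/negP: pc.
  by apply/bigcupP; exists K.
case: ifPn => oR; apply/barrierP; split=> //.
- exact: triv.
- move=> K; rewrite !inE => /orP[/eqP->|/bQ//]; split=> //.
  by rewrite defR subsetDl.
- by rewrite subUset sub1set sBA andbT; move: vR; rewrite inR => /and3P[].
- by apply: triv; apply: subsetDl.
move=> K; rewrite !inE => /orP[/eqP->|KQ]; last first.
  have [sK oK clK] := bQ _ KQ; split=> // [|i ti].
    apply/subsetP => p pK; have := subsetP sK _ pK; rewrite !inE negb_or.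
    case/andP=> -> ->; rewrite !andbT; apply: contraTneq pK => ->.
    have := dR [set v] K; rewrite sub1set vR => /(_ isT KQ).
    by rewrite disjoints1.
  by apply: subset_trans (clK _ ti) _; rewrite setUS // subsetUr.
split.
- apply/subsetP => p; rewrite !inE inR negb_or.
  by case/andP=> -> /and3P[_ -> ->].
- by have := cardsD1 v R; rewrite vR => e; move: oR; rewrite e /= negbK.
move=> i ti; have /clR sN : touch i R.
  by case/touchP: ti => p pi /setD1P[_ pR]; apply/touchP; exists p.
apply: subset_trans sN _; apply/subsetP => p; rewrite !inE.
by case: eqVneq => [_ _|]; rewrite ?orbT.
Qed.

(* Hypergraph version of Diestel, Graph Theory, Theorem 2.2.3.  The witness
   maximizes [#|Q| - #|B|] and then [#|B|]. *)
Lemma barrier_structure A : exists B Q, [/\ barrier A (B, Q), cover Q = A :\: B,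
  {in Q, forall K : {set P}, {in K, forall v, linkable (K :\ v)}} &
  hall_blocks B Q].
Proof.
have [n] := ubnP #|A|; elim: n A => // n IHn A ltAn.
have bA : barrier A (A, set0).
  apply/barrierP; split=> //; last by move=> K; rewrite inE.
  by apply/trivIsetP => K L; rewrite inE.
pose good := [arg max_(c > (A, set0) | barrier A c) score c].
have [[B Q] bBQ maxBQ] : exists2 c, barrier A c &
    forall c', barrier A c' -> score c' <= score c.
  by exists good; rewrite /good; case: arg_maxnP.
have sBA : B \subset A by case/barrierP: bBQ.
have no_better B' Q' : barrier A (B', Q') ->
    (#|Q| + #|B'| < #|Q'| + #|B|) ||
    ((#|Q| + #|B'| == #|Q'| + #|B|) && (#|B| < #|B'|)) -> False.
  by move=> /maxBQ leS /score_lt; rewrite ltnNge leS.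
have hB : hall_blocks B Q.
  move=> B' sB'; rewrite leqNgt; apply/negP => ltB'.
  (* If [B'] has too few adjacent blocks, dropping it along with them increases [#|Q| - #|B|]. *)
  apply: (no_better _ _ (barrier_remove bBQ sB')); apply/orP; left.
  have sQ : [set K in Q | adjacent B' K] \subset Q.
    by apply/subsetP => K; rewrite inE => /andP[].
  have := cardsD B B'; have := cardsD Q [set K in Q | adjacent B' K].
  rewrite (setIidPr sB') (setIidPr sQ).
  have := subset_leq_card sB'; have := subset_leq_card sQ.
  by move: ltB'; move: #|_| #|_| #|_| #|_| #|_| #|_| => *; lia.
have cQ : cover Q = A :\: B.
  have [sQ _] : cover Q \subset A :\: B /\ True.
    by split=> //; apply/bigcupsP => K KQ; case/barrierP: bBQ => _ _ /(_ _ KQ)[].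
  apply/eqP; rewrite eqEsubset sQ -setD_eq0; apply: contraT.
  (* Adding [R] as a block increases the difference when [R] is odd; when it is even, the difference
     is kept and [B] grows. *)
  case/set0Pn => v; set R := _ :\: cover Q => vR.
  have outQ (L : {set P}) p : p \in L -> p \in R -> L \notin Q.
    move=> pL; rewrite inE => /andP[pc _]; apply: contra pc => LQ.
    by apply/bigcupP; exists L.
  have vB : v \notin B by move: vR; rewrite !inE => /and3P[].
  have := barrier_add bBQ (erefl R) vR; case: ifPn => oR /no_better[].
    by rewrite cardsU1 (outQ _ v) // add1n addSn addnC ltnS leqnn.
  have cR : odd #|R :\ v|.
    by move: oR; rewrite (cardsD1 v R) vR /= negbK.
  have /card_gt0P[w wR] : 0 < #|R :\ v| by case: #|_| cR.
  have wR' : w \in R by move: wR; rewrite in_setD1 => /andP[].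
  rewrite !cardsU1 vB (outQ _ w) // !add1n addSn addnS eqxx ltnSn.
  by rewrite orbT.
exists B, Q; split=> // K KQ v vK.
have [_ _ /(_ K KQ)[sK oK _]] := barrierP _ _ _ _ bBQ.
have cK := cardsD1 v K; rewrite vK add1n in cK.
have [|B' [Q' [bB' cQ' fc' hB']]] := IHn (K :\ v).
  rewrite -ltnS; apply: leq_trans ltAn; rewrite ltnS -cK.
  by apply: subset_leq_card; apply: subset_trans sK (subsetDl _ _).
have [leQB|ltBQ] := leqP #|Q'| #|B'|.
  exact: linkable_of_hall bB' cQ' fc' hB' leQB.
(* Since [K :\ v] is even, [#|Q'|] and [#|B'|] have the same parity, so [#|Q'|] is larger by at
   least 2. The split barrier then has no smaller difference and a larger [B]. *)
have [bnew cB2 cQ2] := barrier_split bBQ KQ vK bB'.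
have [sB' tQ' oQ'] := barrierP _ _ _ _ bB'.
have /(odd_blocks tQ') par : {in Q', forall L : {set P}, odd #|L|}.
  by move=> L /oQ'[].
have := cardsD (K :\ v) B'; rewrite (setIidPr sB') -cQ' => cc.
have leB' := subset_leq_card sB'.
rewrite cK /= in oK; case: (no_better _ _ bnew).
move: cc leB' oK ltBQ cB2 cQ2 par; clear.
move: #|_ :|: (_ |: _)| #|_ :|: Q'| #|cover Q'| #|K :\ v| #|B'| #|Q'| #|B| #|Q|.
move=> b2 q2 c k b' q' b q; clear; lia.
Qed.

End Structure.

(** * Attaching the barrier to the blocks *)

Section Assembly.

Variables (I P : finType) (N : I -> {set P}) (i0 : I).
Hypothesis card_N : forall i, #|N i| = 3.
Hypothesis deg_N : forall p, #|star N p| <= 4.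

Local Notation touch := (touch N).
Local Notation linked := (linked N).
Local Notation barrier := (barrier N).
Local Notation adjacent := (adjacent N).
Local Notation cost K := (excess N K [set: I]).

Definition attached (B : {set P}) (R : {set {set P}}) : {set P} :=
  [set b in B | [exists K in R, adjacent [set b] K]].

(** Each block of [R] has at least 4 incidences with attached points. A triple meets at most one
    block and a point lies in at most 4 triples, so these incidences number at most
    [4 * #|attached B R|]. *)
Lemma costly_hall (B : {set P}) (Q R : {set {set P}}) :
    barrier setT (B, Q) -> R \subset Q -> {in R, forall K : {set P}, 3 < cost K} ->
  #|R| <= #|attached B R|.
Proof.
move=> /barrierP[_ tQ bQ] sRQ costly.
have only_K i K L : K \in Q -> L \in Q -> touch i K -> touch i L -> K = L.
  move=> KQ LQ /touchP[p pi pK] tL.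
  apply/eqP; apply: contraT => nKL.
  have dKL : [disjoint K & L] by apply: (trivIsetP tQ).
  have [sK _ _] := bQ _ KQ; have [_ _ /(_ i tL)] := bQ _ LQ.
  move/subsetP/(_ p); rewrite !inE pi (disjointFr dKL pK) => /(_ isT) /= pB.
  by have := subsetP sK _ pK; rewrite !inE pB.
have inB i K b : K \in R -> touch i K -> b \in N i :\: K -> b \in attached B R.
  move=> KR ti; rewrite !inE => /andP[bK bi].
  have [_ _ /(_ i ti)] := bQ _ (subsetP sRQ _ KR).
  move/subsetP/(_ b); rewrite !inE bi (negPf bK) /= => -> //=.
  apply/existsP; exists K; rewrite KR; apply/existsP; exists i; rewrite ti.
  by apply/touchP; exists b; rewrite ?inE.
suff : 4 * #|R| <= 4 * #|attached B R| by rewrite leq_mul2l.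
apply: (@leq_trans (\sum_(K in R) cost K)).
  by rewrite mulnC -sum_nat_const leq_sum // => K /costly.
apply: (@leq_trans (\sum_(i in [set: I]) #|N i :&: attached B R|)); last first.
  rewrite -sum_degIn mulnC -sum_nat_const leq_sum // => b _.
  exact: leq_trans (degIn_le _ _ _) (deg_N b).
rewrite /excess (exchange_big_dep (mem [set: I])) /=; last first.
  by move=> K i _ /andP[].
apply: leq_sum => i _; rewrite (eq_bigl (fun K => (K \in R) && touch i K)).
  have [K /andP[KR ti]|none] := pickP (fun K => (K \in R) && touch i K); last first.
    by rewrite big_pred0.
  rewrite (bigD1 K) ?KR //= big1 ?addn0.
    apply: subset_leq_card; apply/subsetP => b bNK; rewrite inE (inB i K) // andbT.
    by move: bNK; rewrite inE => /andP[].
  move=> L /andP[/andP[LR tL] nLK]; case/negP: nLK; apply/eqP.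
  by apply: (only_K i); rewrite ?(subsetP sRQ).
by move=> K; rewrite inE.
Qed.

(** Saturating [B] and all costly blocks at once is turned into a single application of Hall's
    theorem, with every block choosing a partner. *)
Lemma block_matching (B : {set P}) (Q : {set {set P}}) :
    barrier setT (B, Q) -> hall_blocks N B Q ->
  exists f : P -> {set P}, [/\ {in B &, injective f},
    {in B, forall b, f b \in Q /\ adjacent [set b] (f b)} &
    {in Q, forall K : {set P}, 3 < cost K -> exists2 b, b \in B & f b = K}].
Proof.
move=> bBQ hB.
have [|f0 [inj_f0 adj_f0]] :=
  @hall_marriage _ _ set0 (fun b => [set K in Q | adjacent [set b] K]) B.
  by move=> B' sB'; rewrite adjacent_bigcup; apply: hB.
(* Dummy partners, as many as there are blocks left without a point of [B];
   only the cheap blocks accept them. *)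
have [D cardD] : exists D : {set {set P}}, #|B| + #|D| = #|Q|.
  exists (Q :\: f0 @: B); have sfQ : f0 @: B \subset Q.
    by apply/subsetP => _ /imsetP[b /adj_f0 + ->]; rewrite inE => /andP[].
  by rewrite -(card_in_imset inj_f0) cardsDS // subnKC // subset_leq_card.
pose r K : {set P + {set P}} :=
  inl @: [set b in B | adjacent [set b] K] :|:
  (if cost K <= 3 then inr @: D else set0).
have inl_inj : injective (@inl P {set P}) by move=> x y [].
have inr_inj : injective (@inr P {set P}) by move=> x y [].
have sub_inl (R : {set {set P}}) : R \subset Q -> inl @: attached B R \subset \bigcup_(K in R) r K.
  move=> sRQ; apply/subsetP => _ /imsetP[b + ->]; rewrite inE.
  case/andP=> bB /exists_inP[K KR adj]; apply/bigcupP; exists K => //.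
  by rewrite inE (mem_imset _ _ inl_inj) inE bB adj.
have [|psi [inj_psi psi_r]] := @hall_marriage _ _ (inr set0) r Q.
  move=> R sRQ.
  have [/exists_inP[K KR cK]|] := boolP [exists K in R, cost K <= 3]; last first.
    rewrite negb_exists => /forallP costly.
    apply: leq_trans (subset_leq_card (sub_inl _ sRQ)).
    rewrite card_imset //; apply: costly_hall bBQ sRQ _ => K KR.
    by have := costly K; rewrite KR -ltnNge.
  have sub_inr : inr @: D \subset \bigcup_(K in R) r K.
    by apply: (bigcup_max K); rewrite // /r cK subsetUr.
  have : inl @: attached B R :|: inr @: D \subset \bigcup_(K in R) r K.
    by rewrite subUset sub_inl.
  move/subset_leq_card; apply: leq_trans.
  rewrite cardsU (_ : _ :&: _ = set0) ?cards0 ?subn0; last first.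
    apply/setP => y; rewrite !inE; apply/negP.
    by case/andP => /imsetP[b _ ->] /imsetP[].
  rewrite !card_imset //.
  (* A family [R] with a cheap block may use all of [D]. The barrier points not attached to [R] are
     adjacent only to blocks outside [R], whence [#|B| - #|attached B R| <= #|Q| - #|R|], and this
     suffices by [cardD]. *)
  have := hB (B :\: attached B R) (subsetDl _ _).
  have sat : attached B R \subset B by apply/subsetP => b; rewrite inE => /andP[].
  have : [set K in Q | adjacent (B :\: attached B R) K] \subset Q :\: R.
    apply/subsetP => L; rewrite !inE => /andP[LQ /existsP[i /andP[tL]]].
    case/touchP=> b bi; rewrite !inE => /andP[nb bB]; rewrite LQ andbT.
    apply: contra nb => LR; rewrite bB; apply/exists_inP; exists L => //.
    by apply/existsP; exists i; rewrite tL; apply/touchP; exists b; rewrite ?inE.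
  move/subset_leq_card; rewrite !cardsDS //; move: cardD.
  have := subset_leq_card sat; have := subset_leq_card sRQ.
  move: #|attached B R| #|[set _ in _ | _]| #|R| #|Q| #|B| #|D|.
  by clear; lia.
(* By cardinality every partner is used, in particular every point of [B]. *)
have range : psi @: Q = inl @: B :|: inr @: D.
  apply/eqP; rewrite eqEcard; apply/andP; split.
    apply/subsetP => _ /imsetP[K KQ ->]; have := psi_r _ KQ; rewrite !inE.
    case/orP=> [/imsetP[b + ->]|]; first by rewrite inE => /andP[bB _]; rewrite mem_imset ?bB.
    by case: ifP => [_ ->|]; rewrite ?inE ?orbT.
  rewrite (card_in_imset inj_psi) -cardD.
  by apply: leq_trans (leq_card_setU _ _).1 _; rewrite !card_imset.
pose f b := odflt set0 [pick K in Q | psi K == inl b].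
have fP b : b \in B -> f b \in Q /\ psi (f b) = inl b.
  move=> bB; rewrite /f; case: pickP => [K /andP[KQ /eqP]|none] //=.
  have : inl b \in psi @: Q by rewrite range inE mem_imset ?bB.
  by case/imsetP => K KQ eK; have := none K; rewrite KQ eK eqxx.
have psi_inl K b : K \in Q -> psi K = inl b -> b \in B /\ adjacent [set b] K.
  move=> KQ eK; have := psi_r _ KQ; rewrite eK inE mem_imset // !inE.
  case/orP=> [/andP[]//|]; case: ifP => _; last by rewrite inE.
  by case/imsetP.
exists f; split=> [b c bB cB efc|b bB|K KQ cK].
- have [_ eb] := fP _ bB; have [_ ec] := fP _ cB.
  by apply: inl_inj; rewrite -eb -ec efc.
- by have [fQ eb] := fP _ bB; split=> //; have [] := psi_inl _ _ fQ eb.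
have := psi_r _ KQ; rewrite /r leqNgt cK setU0 => /imsetP[b _ eK].
have [bB _] := psi_inl _ _ KQ eK; exists b => //.
by have [fQ eb] := fP _ bB; apply: inj_psi; rewrite // eb eK.
Qed.

End Assembly.

(** * The triple system *)

Section Triple.

Variables (I P : finType) (N : I -> {set P}).
Hypothesis card_N : forall i, #|N i| = 3.
Hypothesis deg_N : forall p, #|star N p| <= 4.

(** A block enlarged by a barrier point is paired up completely, which leaves degrees at most 3. A
    block left alone is cheap, so [cheap_block_choice] applies. *)
Lemma label_class_choice (A B : {set P}) (Q : {set {set P}}) (f : P -> {set P}) K :
    barrier N [set: P] (B, Q) -> cover Q = [set: P] :\: B ->
    {in Q, forall K : {set P}, {in K, forall v, linkable N (K :\ v)}} ->
    {in B &, injective f} ->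
    {in B, forall b, f b \in Q /\ adjacent N [set b] (f b)} ->
    {in Q, forall K : {set P}, 3 < excess N K [set: I] ->
       exists2 b, b \in B & f b = K} ->
    K \in Q -> A = [set p | block_label B Q f p == K] ->
  exists (C : {set P}) mu own, [/\ C \subset A, linked N C mu own &
    forall X : {set I}, {in C, forall y, own y \notin X} -> balanced N A X].
Proof.
move=> bBQ cQ fc inj_f fB costly KQ defA.
have [sB tQ bQ] := barrierP _ _ _ _ bBQ; have [sK oK clK] := bQ _ KQ.
have fQ : {in B, forall b, f b \in Q} by move=> b /fB[].
have eA : A = [set p in [set: P] | block_label B Q f p == K].
  by rewrite defA; apply/setP => p; rewrite !inE.
have [/exists_inP[b bB /eqP fb]|] := boolP [exists b in B, f b == K].
  have -> : A = b |: K by rewrite eA -fb (block_label_paired sB tQ cQ inj_f fQ bB).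
  have bK := block_label_disjoint cQ KQ bB.
  have adj : adjacent N [set b] K by rewrite -fb; case: (fB _ bB).
  have [mu [own lC]] := linkable_setU1 (fc _ KQ) bK adj.
  exists (b |: K), mu, own; split=> // X avoid; apply: balanced_le3 => p pC.
  have [_ _ _ _ po] := lC _ pC; exact: (degIn_avoid deg_N po (avoid _ pC)).
rewrite negb_exists_in => /forall_inP nfK.
have -> : A = K by rewrite eA (block_label_unpaired tQ cQ KQ).
have nK : K != set0 by apply: contraTneq oK => ->; rewrite cards0.
have cheap : excess N K [set: I] <= 3.
  rewrite leqNgt; apply/negP => /(costly _ KQ)[b bB fb].
  by have := nfK b bB; rewrite fb eqxx.
have [k [mu [own [kK lk bal]]]] := cheap_block_choice card_N deg_N nK cheap (fc _ KQ).
by exists (K :\ k), mu, own; split; rewrite ?subsetDl.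
Qed.

Theorem triple_partition : exists (L : {set I}) (a b f : I -> P),
  [/\ {in L, forall i, [/\ a i \in N i, b i \in N i & a i != b i]},
      {in L &, forall i j, i != j -> [disjoint [set a i; b i] & [set a j; b j]]},
      {in ~: L &, injective f} & {in ~: L, forall i, f i \in N i}].
Proof.
have [i0 _|I0] := pickP (@predT I); last first.
  have emptyI (i : I) : False by have := I0 i.
  have any (i : I) : P by case: (emptyI i).
  by exists set0, any, any, any; split=> i; case: (emptyI i).
have /card_gt0P[p0 _] : 0 < #|N i0| by rewrite card_N.
have [B [Q [bBQ cQ fc hB]]] := barrier_structure N i0 [set: P].
have [g [inj_g gB costly]] := block_matching deg_N bBQ hB.
have gQ : {in B, forall b, g b \in Q} by move=> b /gB[].
pose label := block_label B Q g.
have labQ p : label p \in Q by apply: (block_label_in cQ gQ); rewrite inE.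
pose A K := [set p | label p == K].
have [w wP] : exists w : {set P} -> {set P} * (P -> P) * (P -> I),
    forall K, K \in Q -> [/\ (w K).1.1 \subset A K,
      linked N (w K).1.1 (w K).1.2 (w K).2 & forall X : {set I},
      {in (w K).1.1, forall y, (w K).2 y \notin X} -> balanced N (A K) X].
  apply: (@fin_all_exists _ _ (fun K (u : {set P} * (P -> P) * (P -> I)) =>
    K \in Q -> [/\ u.1.1 \subset A K, linked N u.1.1 u.1.2 u.2 &
     forall X : {set I}, {in u.1.1, forall y, u.2 y \notin X} ->
       balanced N (A K) X])) => K.
  have [KQ|_] := boolP (K \in Q); last by exists (set0, id, fun=> i0).
  have [C [mu [own [? ? ?]]]] :=
    label_class_choice bBQ cQ fc inj_g gB costly KQ (erefl (A K)).
  by exists (C, mu, own).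
pose C := \bigcup_(K in Q) (w K).1.1.
pose mu p := (w (label p)).1.2 p; pose own p := (w (label p)).2 p.
have labC : {in Q, forall K, {in (w K).1.1, forall p, label p = K}}.
  by move=> K /wP[/subsetP sC _ _] p /sC; rewrite inE => /eqP.
have lC : linked N C mu own.
  have lw : {in Q, forall K, linked N (w K).1.1 (w K).1.2 (w K).2}.
    by move=> K /wP[].
  exact: (linked_glue lw labC).
pose L := own @: C.
have [|f [inj_f fN]] := @hall_marriage _ _ p0 N (~: L).
  move=> X sX; rewrite -/(cov N X) -(@leq_pmul2l 3) //.
  have -> : 3 * #|X| = \sum_p degIn N X p.
    rewrite (eq_bigl (fun p => p \in [set: P])) => [|p]; last by rewrite inE.
    rewrite sum_degIn mulnC -sum_nat_const.
    by apply: eq_bigr => i _; rewrite setIT card_N.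
  rewrite (partition_big label (mem Q)) //=.
  have -> : 3 * #|cov N X| = \sum_(K in Q) 3 * #|A K :&: cov N X|.
    rewrite -big_distrr /= -sum1_card (partition_big label (mem Q)) //=.
    congr (_ * _); apply: eq_bigr => K _; rewrite -sum1_card.
    by apply: eq_bigl => p; rewrite !inE andbC.
  apply: leq_sum => K KQ; have [sC _ bal] := wP _ KQ.
  have := bal X _; rewrite /balanced (eq_bigl (fun p => label p == K)); last first.
    by move=> p; rewrite inE.
  apply=> y yC; apply/negP => /(subsetP sX); rewrite inE => /negP[].
  apply/imsetP; exists y; first by apply/bigcupP; exists K.
  by rewrite /own (labC _ KQ).
(* Several pairs may have the same owner; one of them is kept for each triple of [L]. Pairs with
   different owners are disjoint because [own] is constant on a pair. *)
pose a i := odflt p0 [pick y in C | own y == i].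
have aP i : i \in L -> a i \in C /\ own (a i) = i.
  case/imsetP => y yC eo; rewrite /a; case: pickP => [z /andP[zC /eqP]//|].
  by move/(_ y); rewrite yC eo eqxx.
have own_ab i z : i \in L -> z \in [set a i; mu (a i)] -> own z = i.
  move=> iL; have [aC oa] := aP _ iL; have [_ _ _ om _] := lC _ aC.
  by rewrite !inE => /orP[]/eqP->; rewrite ?om.
exists L, a, (fun i => mu (a i)), f; split=> // [i iL|i j iL jL nij].
  have [aC oa] := aP _ iL; have [mC nm _ om ao] := lC _ aC.
  have [_ _ _ _] := lC _ mC; rewrite om oa => mi.
  by rewrite eq_sym nm mi -{2}oa.
apply/pred0P => z /=; apply/negP => /andP[/(own_ab _ _ iL) ei /(own_ab _ _ jL) ej].
by case/eqP: nij; rewrite -ei.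
Qed.

End Triple.

(** * Back to the bipartite graph *)

Theorem mainTheorem1 (V : finType) (e : rel V) (S T : {set V})
    (hG : simple_graph e)
    (hST : bipartition e S T)
    (hS : forall v : V, v \in S -> degree e v <= 4)
    (hT : forall v : V, v \in T -> degree e v <= 3) :
  exists (M : {set {set V}}) (F : {set V * V * V}),
    [/\ matching e M,
        disjoint_S_links e S F &
        forall v : V, v \in T -> degree e v = 3 ->
          exists2 f : {set V},
            f \in M :|: \bigcup_(P in F) link_edges P & v \in f].
Proof.
have [sym_e irr_e] := hG; have [_ disST eST] := hST.
pose I := {v : V | (v \in T) && (degree e v == 3)}.
pose N (i : I) := [set w | e (val i) w].
have iT (i : I) : val i \in T by case/andP: (valP i).
have NS (i : I) w : w \in N i -> w \in S.
  rewrite inE => /eST/orP[/andP[iS _]|/andP[_ //]].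
  by have := disjointFr disST iS; rewrite iT.
have card_N i : #|N i| = 3 by case/andP: (valP i) => _ /eqP.
have deg_N w : #|star N w| <= 4.
  have [wS|wS] := boolP (w \in S).
    apply: leq_trans (hS _ wS); rewrite -(card_imset _ val_inj) subset_leq_card //.
    by apply/subsetP => _ /imsetP[i + ->]; rewrite !inE sym_e.
  rewrite (_ : star N w = set0) ?cards0 //; apply/setP => i; rewrite inE in_set0.
  by apply: contraNF wS; apply: NS.
have [L [a [b [f [abN dis inj_f fN]]]]] := triple_partition card_N deg_N.
(* Representatives give the matching edges, and the pair chosen inside a triple gives the ends of
   the link with that node in the middle. *)
pose M := [set [set val i; f i] | i in ~: L].
pose F := [set (a i, val i, b i) | i in L].
have notS (i : I) : val i \notin S.
  by apply/negP => iS; have := disjointFr disST iS; rewrite iT.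
exists M, F; split.
- split.
    apply/subsetP => _ /imsetP[i iL ->]; apply/imsetP; exists (val i, f i) => //.
    by have := fN _ iL; rewrite !inE.
  move=> v; apply/card_le1_eqP => g h.
  rewrite !inE => /andP[/imsetP[i iL ->] vi] /andP[/imsetP[j jL ->] vj].
  suff -> : i = j by [].
  have fiS := NS _ _ (fN _ iL); have fjS := NS _ _ (fN _ jL).
  move: vi vj; rewrite !inE => /orP[]/eqP-> /orP[]/eqP e1.
  + exact: val_inj.
  + by case/negP: (notS i); rewrite e1.
  + by case/negP: (notS j); rewrite -e1.
  + exact: inj_f.
- split=> [_ /imsetP[i iL ->]|_ _ /imsetP[i iL ->] /imsetP[j jL ->] nP].
    have [ai bi nab] := abN _ iL; rewrite /S_link nab (NS _ _ ai) (NS _ _ bi).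
    by move: ai bi; rewrite !inE sym_e => -> ->.
  have nij : i != j by apply: contraNneq nP => ->.
  have [ai bi _] := abN _ iL; have [aj bj _] := abN _ jL.
  have := dis _ _ iL jL nij; move/pred0P => dij.
  apply/pred0P => z /=; apply/negP; rewrite /link_nodes.
  (* Middle nodes lie outside [S] and end-nodes inside, so two links can only share a middle node or
     an end-node of both. *)
  have linkS k : k \in L -> z \in [set a k; val k; b k] ->
      z = val k \/ z \in [set a k; b k] /\ z \in S.
    move=> kL; have [/NS ak /NS bk _] := abN _ kL; rewrite !inE.
    by case/orP => [/orP[]|] /eqP->; rewrite ?eqxx ?orbT; auto.
  case/andP => /(linkS _ iL)[ei|[zi ziS]] /(linkS _ jL)[ej|[zj zjS]].
  + by case/eqP: nij; apply: val_inj; rewrite -ei.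
  + by case/negP: (notS i); rewrite -ei.
  + by case/negP: (notS j); rewrite -ej.
  + by have := dij z; rewrite /= zi zj.
move=> v vT dv.
have vI : (v \in T) && (degree e v == 3) by rewrite vT dv eqxx.
pose i : I := Sub v vI.
have [iL|iL] := boolP (i \in L).
  exists [set a i; v]; last by rewrite !inE eqxx orbT.
  rewrite inE; apply/orP; right; apply/bigcupP; exists (a i, v, b i).
    by apply/imsetP; exists i.
  by rewrite !inE eqxx.
exists [set v; f i]; last by rewrite !inE eqxx.
by rewrite inE; apply/orP; left; apply/imsetP; exists i; rewrite ?inE.
Qed.
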